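(* Let $n\ge 1$ and let $L \in \mathcal{L}_n$. Then the number of $P_3$-matches in $L$, where $P_3=NEEN$, equals $\mathrm{cross}^{h}(L)$. Hence, by symmetry, the number of $P_4$-matches in $L$, where $P_4=ENNE$, equals $\mathrm{cross}^{v}(L)$.
   Context: $\mathcal{L}_n$ is the set of lattice paths from $(0,0)$ to $(n,n)$ consisting of unit north steps $N=(0,1)$ and unit east steps $E=(1,0)$, equivalently words with $n$ letters $E$ and $n$ letters $N$. For $L\in\mathcal{L}_n$ and $A\subseteq\{1,\dots,n\}$, $ps_L(A)$ is the word obtained from $L$ by deleting, for every $i\in\{1,\dots,n\}\setminus A$, the $i$-th occurrence of $E$ and the $i$-th occurrence of $N$ (reading from left to right). For $P\in\mathcal{L}_2$, the number of $P$-matches in $L$ is the number of $j\in\{1,\dots,n-1\}$ with $ps_L(\{j,j+1\})=P$. $\mathrm{cross}^{h}(L)$ is the number of points $(x,x)$ on $L$ such that the preceding step of $L$ and the following step of $L$ are both east steps. $\mathrm{cross}^{v}(L)$ is the number of points $(y,y)$ on $L$ such that the preceding step and the following step are both north steps. *)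

(* Defs.v *)
From HB Require Import structures.
From mathcomp Require Import all_boot.

Set Implicit Arguments.
Unset Strict Implicit.
Unset Printing Implicit Defensive.

Inductive step := North | East.

Definition step_is_east (s : step) : bool := if s is East then true else false.
Definition step_of_bool (b : bool) : step := if b then East else North.

Lemma step_is_eastK : cancel step_is_east step_of_bool.
Proof. by case. Qed.

HB.instance Definition _ := Equality.copy step (can_type step_is_eastK).

(* A path is the word of its steps, starting from (0,0). *)
Definition path_word := seq step.

(* A path starting from (0,0) ends at (n,n) iff it has n steps of each kind. *)
Definition lattice_paths (n : nat) : pred path_word :=
  [pred L | (count_mem East L == n) && (count_mem North L == n)].

(* The lattice point reached by L after k steps, for k <= size L. *)
Definition point (L : path_word) (k : nat) : nat * nat :=
  (count_mem East (take k L), count_mem North (take k L)).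

(* The step at (0-based) position k of L is the [occurrence L k]-th occurrence
   of its own letter; occurrences are numbered from 1. *)
Definition occurrence (L : path_word) (k : nat) : nat :=
  count_mem (nth North L k) (take k.+1 L).

(* For L in lattice_paths n, only the trace of A on {1, ..., n} matters: deleting
   the i-th East and the i-th North for all i in {1, ..., n} \ A amounts to
   keeping the letters whose occurrence number is in A. *)
Definition ps (L : path_word) (A : pred nat) : path_word :=
  mask [seq A (occurrence L k) | k <- iota 0 (size L)] L.

(* j ranges over {1, ..., n - 1}. *)
Definition matches (n : nat) (P L : path_word) : nat :=
  count (fun j => ps L (pred2 j j.+1) == P) (iota 1 n.-1).

(* The number of diagonal points of L that are preceded and followed by a step s.
   Steps only go north or east, so distinct positions k give distinct points;
   only the positions 0 < k < size L have both a preceding and a following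
   step. *)
Definition cross (s : step) (L : path_word) : nat :=
  count (fun k => [&& (point L k).1 == (point L k).2,
                      nth North L k.-1 == s & nth North L k == s])
        (iota 1 (size L).-1).

Definition crossh (L : path_word) : nat := cross East L.
Definition crossv (L : path_word) : nat := cross North L.

Definition P3 : path_word := [:: North; East; East; North].
Definition P4 : path_word := [:: East; North; North; East].

(* Main.v *)
Require Import Defs.
From mathcomp Require Import all_boot.
From mathcomp Require Import zify.

(** Write [s] for the repeated letter of the pattern and [t] for the other one,
    and cut [L] after its first [2j] steps, at the point [(a, b)].  The word
    [ps L {j, j+1}] is the contribution of the prefix followed by that of the
    suffix.  If it is [tsst] then [a = b = j]: otherwise, as [a + b = 2j], the
    prefix would contribute two letters of one kind and none of the other, and
    no prefix of [tsst] has this form.  So the prefix contributes [ts] and the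
    suffix [st].  The steps before and after [(j, j)] are the [j]-th and the
    [j+1]-th of their kinds, hence are kept, and must both be [s]; conversely,
    if they are [s], the letters [t] surround them.  Diagonal points occur only
    after an even number of steps, so matches and crossings correspond. *)

Definition opp (s : step) : step := if s is North then East else North.

Lemma size_count_step (s : step) (w : path_word) :
  size w = count_mem s w + count_mem (opp s) w.
Proof. by elim: w => //= x w ->; case: s; case: x; rewrite /= ; lia. Qed.

Lemma word_of_counts01 (s : step) (w : path_word) :
  count_mem s w = 0 -> count_mem (opp s) w = 1 -> w = [:: opp s].
Proof.
move=> w0 w1; have := size_count_step s w; rewrite w0 w1.
by case: w w0 w1 => [|x [|]] //=; case: s; case: x.
Qed.

(** A prefix without [s] stops before the second letter. This lemma and the next exclude the letter
    counts (0, 2) and (2, 0). *)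
Lemma prefix_tsst_counts02 (s : step) (w : path_word) :
  prefix w [:: opp s; s; s; opp s] ->
  count_mem s w = 0 -> count_mem (opp s) w <= 1.
Proof.
by case: w => [|a [|b [|c [|d [|e w]]]]] //; case: s; case: a => //;
  try case: b => //; try case: c => //; try case: d.
Qed.

Lemma prefix_tsst_counts20 (s : step) (w : path_word) :
  prefix w [:: opp s; s; s; opp s] ->
  count_mem (opp s) w = 0 -> count_mem s w = 0.
Proof. by case: w => [|a w] //; case: s; case: a. Qed.

Lemma prefix_tsst_counts11 (s : step) (w : path_word) :
  prefix w [:: opp s; s; s; opp s] ->
  count_mem s w = 1 -> count_mem (opp s) w = 1 -> w = [:: opp s; s].
Proof.
by case: w => [|a [|b [|c [|d [|e w]]]]] //; case: s; case: a => //;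
  try case: b => //; try case: c => //; try case: d.
Qed.

(** Occurrence numbers depend only on what lies to the left, so [ps] can be computed by recursion on
    the last letter. *)
Lemma ps_rcons (L : path_word) (x : step) (A : pred nat) :
  ps (rcons L x) A = ps L A ++ nseq (A (count_mem x L).+1) x.
Proof.
rewrite /ps size_rcons -addn1 iotaD map_cat -{3}cats1 mask_cat; last first.
  by rewrite size_map size_iota.
congr (_ ++ _).
  congr mask; apply/eq_in_map => k; rewrite mem_iota /= add0n => ltk.
  by rewrite /occurrence nth_rcons ltk -cats1 takel_cat.
rewrite /= add0n /occurrence nth_rcons ltnn eqxx -(size_rcons L x) take_size.
by rewrite -cats1 count_cat /= eqxx addn0 addn1; case: (A _).
Qed.

Lemma count_ps (x : step) (L : path_word) (A : pred nat) :
  count_mem x (ps L A) = count A (iota 1 (count_mem x L)).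
Proof.
elim/last_ind: L => // L y IHL.
rewrite ps_rcons count_cat IHL -cats1 count_cat count_nseq /= addn0.
have [->|_] := eqVneq y x; last by rewrite mul0n !addn0.
by rewrite iotaD count_cat /= mul1n addn0 add1n.
Qed.

Lemma count_pred2_iota (j c : nat) :
  0 < j -> count (pred2 j j.+1) (iota 1 c) = (j <= c) + (j < c).
Proof.
move=> j0; elim: c => [|c IHc]; first by rewrite /=; lia.
by rewrite -[c.+1]addn1 iotaD count_cat IHc /=; lia.
Qed.

Lemma prefix_ps_take (L : path_word) (k : nat) (A : pred nat) :
  prefix (ps (take k L) A) (ps L A).
Proof.
rewrite -{2}(cat_take_drop k L); elim/last_ind: (drop k L) => [|w x IHw].
  by rewrite cats0 prefix_refl.
by rewrite -rcons_cat ps_rcons; apply: prefix_trans IHw (prefix_prefix _ _).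
Qed.

Lemma ps_tsst_cross (n j : nat) (s : step) (L : path_word) :
    L \in lattice_paths n -> 0 < j < n ->
  (ps L (pred2 j j.+1) == [:: opp s; s; s; opp s]) =
  [&& (point L j.*2).1 == (point L j.*2).2,
      nth North L j.*2.-1 == s & nth North L j.*2 == s].
Proof.
case/andP=> /eqP LE /eqP LN /andP[j0 jn].
have Ls x : count_mem x L = n by case: x.
have szL : size L = n.*2 by rewrite (size_count_step s) !Ls addnn.
set A := pred2 j j.+1; set y := nth North L _.-1; set x := nth North L _.
pose M := take j.*2.-1 L.
have def1 : take j.*2 L = rcons M y.
  by rewrite -take_nth ?prednK //; lia.
have def2 : take j.*2.+1 L = rcons (rcons M y) x.
  by rewrite -def1 -take_nth //; lia.
(* The sum is 0, 1 or 2 according as the count is below, equal to or above [j]. *)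
have cA z w : count_mem z (ps w A) = (j <= count_mem z w) + (j < count_mem z w).
  by rewrite count_ps count_pred2_iota.
have szM : count_mem s (rcons M y) + count_mem (opp s) (rcons M y) = j.*2.
  by rewrite -size_count_step -def1 size_takel //; lia.
have diagE : ((point L j.*2).1 == (point L j.*2).2) =
    (count_mem s (rcons M y) == j) && (count_mem (opp s) (rcons M y) == j).
  by rewrite /point def1 /=; case: s szM => /=; lia.
have pre1 := prefix_ps_take L j.*2 A; have pre2 := prefix_ps_take L j.*2.+1 A.
rewrite def1 in pre1; rewrite def2 in pre2; rewrite diagE.
have psMy : count_mem y (rcons M y) = j -> ps (rcons M y) A = rcons (ps M A) y.
  rewrite -cats1 count_cat /= eqxx addn0 addn1 cats1 => cy.
  by rewrite ps_rcons cy /A /= eqxx cats1.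
have psMyx : count_mem x (rcons M y) = j ->
    ps (rcons (rcons M y) x) A = rcons (ps (rcons M y) A) x.
  by move=> cx; rewrite ps_rcons cx /A /= eqxx orbT cats1.
apply/eqP/and3P => [psL | [/andP[/eqP cs /eqP ct] /eqP ys /eqP xs]].
  rewrite psL in pre1 pre2.
  have cs : count_mem s (rcons M y) = j.
    have := prefix_tsst_counts02 _ _ pre1; have := prefix_tsst_counts20 _ _ pre1.
    by rewrite !cA; lia.
  have ct : count_mem (opp s) (rcons M y) = j by lia.
  have cz z : count_mem z (rcons M y) = j by case: (s) (z) cs ct => [] [].
  have ps1 : ps (rcons M y) A = [:: opp s; s].
    by apply: prefix_tsst_counts11 pre1 _ _; rewrite cA ?cs ?ct leqnn ltnn.
  rewrite cs ct eqxx; split=> //.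
    have := psMy (cz y); rewrite ps1 -[[:: _; _]]/(rcons [:: opp s] s).
    by move/rcons_inj => [_ ->].
  by move: pre2; rewrite psMyx ?cz // ps1 /= !eqxx /= andbT.
rewrite ys xs in psMy psMyx pre1 pre2 cs ct.
(* Without the final [s], [M] has [j.-1] letters [s] and [j] letters [opp s], so only its last
   [opp s] is kept. *)
have psM : ps M A = [:: opp s].
  apply: word_of_counts01; rewrite cA; move: cs ct;
    rewrite -cats1 !count_cat /= eqxx; case: (s) => /=; lia.
move: pre2; rewrite psMyx // psMy // psM => /prefixP[R psL].
(* Since [j < n], [ps L A] has two letters of each kind; three of the four precede [R]. *)
have := cA s L; have := cA (opp s) L; rewrite !Ls psL !count_cat => cR cR'.
suff -> : R = [:: opp s] by [].
by apply: word_of_counts01; move: cR cR'; case: (s) => /=; lia.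
Qed.

(** With [m = n.-1], the left range is that of the interior positions of a path of length [n.*2],
    and the right one is that of the indices [j] of [matches]. *)
Lemma count_even_iota (Q : pred nat) (m : nat) :
    (forall k, odd k -> ~~ Q k) ->
  count Q (iota 1 m.*2.+1) = count (fun j => Q j.*2) (iota 1 m).
Proof.
move=> Qodd; elim: m => [|m IHm].
  by rewrite /= (negbTE (Qodd 1 _)).
rewrite doubleS -[m.*2.+3]addn2 -(addn1 m) (iotaD 1 m 1) (iotaD 1 _ 2).
rewrite !count_cat IHm /=.
rewrite !add1n doubleS (negbTE (Qodd m.*2.+3 _)) ?addn0 //=.
by rewrite odd_double.
Qed.

Lemma matches_tsst_cross (n : nat) (s : step) (L : path_word) :
    0 < n -> L \in lattice_paths n ->
  matches n [:: opp s; s; s; opp s] L = cross s L.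
Proof.
move=> n0 hL; have szL : size L = n.*2.
  by case/andP: hL => /eqP LE /eqP LN; rewrite (size_count_step East) LE LN addnn.
rewrite /cross szL.
(* Beyond the end of [L] the point stays at [(n, n)] and [nth] gives junk, so
   parity excludes a position [k] only when [k <= size L]. *)
pose Q k := [&& k <= n.*2, (point L k).1 == (point L k).2,
                nth North L k.-1 == s & nth North L k == s].
have Qodd k : odd k -> ~~ Q k.
  move=> kodd; apply/negP=> /and3P[lek /eqP diag _].
  have := size_count_step East (take k L); rewrite size_takel ?szL //.
  by move: diag; rewrite /point /= => -> /(congr1 odd); rewrite addnn odd_double kodd.
rewrite (@eq_in_count _ _ Q) => [|k]; last first.
  by rewrite mem_iota /Q => /andP[_ ltk]; rewrite (_ : k <= n.*2) //; lia.
have -> : n.*2.-1 = n.-1.*2.+1 by lia.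
rewrite count_even_iota //; apply: eq_in_count => j; rewrite mem_iota => lej.
have hj : 0 < j < n by lia.
have le2 : j.*2 <= n.*2 by lia.
by rewrite (ps_tsst_cross _ _ s _ hL hj) /Q le2.
Qed.

Theorem theorem5 (n : nat) (L : path_word) (hn : 1 <= n)
    (hL : L \in lattice_paths n) :
  matches n P3 L = crossh L /\ matches n P4 L = crossv L.
Proof.
by split; [apply: (@matches_tsst_cross n East) | apply: (@matches_tsst_cross n North)].
Qed.
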